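(* Let $\mathcal{A}$ be an algebra (containing the identity) of linear operators acting on the linear space $\mathbb{P}$ of real polynomials, and let $(p_n)_{n\ge 0}$ be a sequence of polynomials with $\deg p_n=n$. Assume that there are an operator $D_p\in\mathcal{A}$ and numbers $\theta_n$, $n\ge 0$, such that $D_p(p_n)=\theta_np_n$ for $n\ge 0$. Let $(\varepsilon_n)_n$ and $(\sigma_n)_n$ be two sequences of numbers which define a $\mathcal{D}$-operator $\mathcal{D}$ of type 2 for $(p_n)_n$ and $\mathcal{A}$. Let $P_2$ be an arbitrary polynomial such that $P_2(\theta_n)\neq 0$ for $n\ge 0$, and let the sequences $(\gamma_n)_{n\ge 1}$ and $(\lambda_n)_{n\ge 0}$ satisfy $$\gamma_{n+1}=P_2(\theta_n)\ (n\ge 0),\qquad \lambda_n-\lambda_{n-1}=\sigma_n\gamma_n\ (n\ge 1).$$ Assume that there exists a polynomial $P_1$ such that $\lambda_{n+1}+\lambda_n=P_1(\theta_n)$ for all $n\ge 0$. Define $q_0=1$ and $$q_n=p_n+\beta_np_{n-1},\qquad \beta_n=\varepsilon_n\frac{\gamma_{n+1}}{\gamma_n},\qquad n\ge 1.$$ Then the operator $$D_q=\tfrac12P_1(D_p)+\mathcal{D}\,P_2(D_p)$$ satisfies $D_q(q_n)=\lambda_nq_n$ for all $n\ge 0$. Moreover $D_q\in\mathcal{A}$.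
   Context: $\mathcal{D}$-operators of type 2: given the sequence $(p_n)_n$ with $\deg p_n=n$ and sequences of numbers $(\varepsilon_n)_n$, $(\sigma_n)_n$, let $\zeta:\mathbb{P}\to\mathbb{P}$ be the linear operator with $\zeta(p_n)=\varepsilon_np_{n-1}$ for $n\ge 0$ (with $p_{-1}=0$), and let $\mathcal{D}:\mathbb{P}\to\mathbb{P}$ be the linear operator with $$\mathcal{D}(p_n)=-\tfrac12\sigma_{n+1}p_n+\sum_{j=1}^n(-1)^{j+1}\sigma_{n+1-j}\,\zeta^j(p_n),\qquad n\ge 0.$$ One says that $(\varepsilon_n)_n$, $(\sigma_n)_n$ define a $\mathcal{D}$-operator of type 2 for $(p_n)_n$ and $\mathcal{A}$ if $\mathcal{D}\in\mathcal{A}$. For a linear operator $T$ and a polynomial $P(x)=\sum_ja_jx^j$, $P(T)=\sum_ja_jT^j$; products of operators are compositions. *)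

(* Defs.v *)
From mathcomp Require Import all_boot all_order all_algebra.
From mathcomp Require Import boolp classical_sets functions reals.

Set Implicit Arguments.
Unset Strict Implicit.
Unset Printing Implicit Defensive.

Import Order.TTheory GRing.Theory Num.Theory.
Local Open Scope ring_scope.


Record operator_algebra (R : realType) (A : set ({poly R} -> {poly R})) : Prop :=
  OperatorAlgebra {
    opalg_linear : forall T, A T -> linear T;
    opalg_id : A id;
    opalg_add : forall T U, A T -> A U -> A (T + U);
    opalg_scale : forall (a : R) T, A T -> A (a *: T);
    opalg_comp : forall T U, A T -> A U -> A (T \o U) }.

(* Pol(T), the powers of T being iterated compositions. *)
Definition op_poly (R : realType) (Pol : {poly R}) (T : {poly R} -> {poly R}) :
    {poly R} -> {poly R} :=
  \sum_(j < size Pol) Pol`_j *: iter j T.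

Definition lowering_operator (R : realType) (p : nat -> {poly R})
    (eps : nat -> R) (zeta : {poly R} -> {poly R}) : Prop :=
  linear zeta /\
  forall n, zeta (p n) = eps n *: (if n is m.+1 then p m else 0).

(* When deg p_n = n for all n, the p_n form a basis, so zeta and D exist and
   are determined by their values on it. *)
Definition D_operator_type2 (R : realType) (p : nat -> {poly R})
    (eps sigma : nat -> R) (D : {poly R} -> {poly R}) : Prop :=
  linear D /\
  exists2 zeta, lowering_operator p eps zeta &
  forall n, D (p n) =
    - (2^-1 * sigma n.+1) *: p n
    + \sum_(1 <= j < n.+1)
        ((-1) ^+ j.+1 * sigma (n.+1 - j)%N) *: iter j zeta (p n).

Definition beta (R : realType) (eps gamma : nat -> R) (n : nat) : R :=
  eps n * (gamma n.+1 / gamma n).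

Definition q_seq (R : realType) (p : nat -> {poly R}) (eps gamma : nat -> R)
    (n : nat) : {poly R} :=
  if n is m.+1 then p n + beta eps gamma n *: p m else 1.

Definition D_q (R : realType) (P1 P2 : {poly R}) (Dp D : {poly R} -> {poly R}) :
    {poly R} -> {poly R} :=
  (2^-1 *: op_poly P1 Dp) + (D \o op_poly P2 Dp).

(* Main.v *)
Require Import Defs.
From mathcomp Require Import all_boot all_order all_algebra.
From mathcomp Require Import boolp classical_sets functions reals.
From mathcomp Require Import ring.

Import Order.TTheory GRing.Theory Num.Theory.
Local Open Scope ring_scope.

(** Pulling one factor [zeta] out of the sum that defines [D (p n.+1)] turns it
into the sum for [D (p n)] with the opposite sign, so that the long sum
collapses in a combination of two neighbours ([D_type2_recurrence]):
[[
D p_(n+1) + eps_(n+1) D p_n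
  = - sigma_(n+2)/2 p_(n+1) + eps_(n+1) sigma_(n+1)/2 p_n.
]]
On the other hand [op_poly P Dp] acts on [p n] as the scalar [P.[theta n]]
([op_poly_eigen]), hence
[[
D_q p_n = (lambda_(n+1) + lambda_n)/2 p_n + gamma_(n+1) D p_n.
]]
The coefficient [beta] is chosen so that
[beta_(n+1) gamma_(n+1) = eps_(n+1) gamma_(n+2)]: in [D_q q_(n+1)] the two
values of [D] then occur in exactly the combination above, multiplied by
[gamma_(n+2)].  Since [sigma_k gamma_k = lambda_k - lambda_(k-1)], that
combination contributes half differences of consecutive [lambda]s, the term
[P1(Dp)] contributes their half sums, and they add up to
[lambda_(n+1)] on [p_(n+1)] and to [beta_(n+1) lambda_(n+1)] on [p_n].  For [n = 0], the polynomial [1] is a scalar multiple of [p 0],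
and the half sum minus the half difference is [lambda_0].

Membership in the algebra holds because a polynomial in [Dp] is a linear
combination of iterated compositions ([op_poly_in_algebra]). *)

Lemma iter_scalable {R : realType} {T : {poly R} -> {poly R}} j :
  scalable T -> scalable (iter j T).
Proof. by move=> TZ a u; elim: j => //= j ->; rewrite TZ. Qed.

Lemma op_polyE (R : realType) (P : {poly R}) T u :
  op_poly P T u = \sum_(j < size P) P`_j *: iter j T u.
Proof. by rewrite /op_poly fct_sumE. Qed.

Lemma op_poly_eigen {R : realType} (P : {poly R}) {T u} {t : R} :
  scalable T -> T u = t *: u -> op_poly P T u = P.[t] *: u.
Proof.
move=> TZ Tu; rewrite op_polyE horner_coef scaler_suml.
apply: eq_bigr => j _; rewrite -scalerA; congr (_ *: _).
elim: (nat_of_ord j) => [|k IHk] /=; first by rewrite expr0 scale1r.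
by rewrite IHk TZ Tu scalerA exprSr.
Qed.

(** The algebra contains the zero operator as [0 *: id], which covers the empty
sum, that is, the zero polynomial. *)
Lemma op_poly_in_algebra (R : realType) (A : set ({poly R} -> {poly R}))
    (P : {poly R}) T :
  operator_algebra A -> A T -> A (op_poly P T).
Proof.
move=> hA AT; rewrite /op_poly; apply: (big_ind A).
- rewrite -(scale0r (id : {poly R} -> {poly R})).
  exact: opalg_scale hA _ _ (opalg_id hA).
- exact: opalg_add hA.
move=> j _; apply: (opalg_scale hA).
elim: (nat_of_ord j) => [|k IHk]; first exact: opalg_id hA.
exact: (opalg_comp hA AT IHk).
Qed.

(** In [D (p n.+1)] the terms with [2 <= j] cancel against the sum in
[eps n.+1 *: D (p n)].  The term [j = 1] is [eps n.+1 * sigma n.+1] times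
[p n]; the leading term of [eps n.+1 *: D (p n)] removes half of it. *)
Lemma D_type2_recurrence {R : realType} {p : nat -> {poly R}}
    {eps sigma : nat -> R} {D : {poly R} -> {poly R}} n :
  D_operator_type2 p eps sigma D ->
  D (p n.+1) + eps n.+1 *: D (p n) =
  - (2^-1 * sigma n.+2) *: p n.+1 + (eps n.+1 * (2^-1 * sigma n.+1)) *: p n.
Proof.
move=> [_ [zeta [linz zetap] Dp]].
have zetaZ : scalable zeta := GRing.scalable_linear linz.
rewrite !Dp big_nat_recl //= zetap subn1 /= sqrrN expr1n mul1r.
(* Since zeta^(j+1) p_(n+1) = eps_(n+1) zeta^j p_n and the sign alternates,
   each remaining term is - eps_(n+1) times a term of the sum for n. *)
set S := \sum_(1 <= j < n.+1) _; set S' := \sum_(1 <= j < n.+1) _.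
have -> : S = - (eps n.+1 *: S').
  rewrite /S /S' scaler_sumr -sumrN; apply: eq_bigr => j _.
  rewrite -iterS iterSr zetap (iter_scalable j zetaZ).
  by rewrite subSS !scalerA -scaleNr; congr (_ *: _); rewrite exprS; ring.
have : sigma n.+1 = 2^-1 * sigma n.+1 + 2^-1 * sigma n.+1 by field.
move: S' (2^-1 * sigma n.+1) => {}S' s ->.
by rewrite -!mul_polyC !(rmorphM, rmorphN, rmorphD) /=; ring.
Qed.

Lemma D_type2_0 {R : realType} {p : nat -> {poly R}}
    {eps sigma : nat -> R} {D : {poly R} -> {poly R}} :
  D_operator_type2 p eps sigma D -> D (p 0%N) = - (2^-1 * sigma 1%N) *: p 0%N.
Proof. by move=> [_ [zeta _ ->]]; rewrite big_geq ?addr0. Qed.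

Theorem lemma3p2 (R : realType) (A : set ({poly R} -> {poly R}))
    (p : nat -> {poly R}) (Dp : {poly R} -> {poly R}) (theta : nat -> R)
    (eps sigma : nat -> R) (D : {poly R} -> {poly R})
    (P1 P2 : {poly R}) (gamma lambda : nat -> R)
    (hA : operator_algebra A)
    (hp : forall n, size (p n) = n.+1)
    (hDpA : A Dp)
    (hDp : forall n, Dp (p n) = theta n *: p n)
    (hD : D_operator_type2 p eps sigma D)
    (hDA : A D)
    (hP2 : forall n, P2.[theta n] != 0)
    (hgamma : forall n, gamma n.+1 = P2.[theta n])
    (hlambda : forall n, (1 <= n)%N -> lambda n - lambda n.-1 = sigma n * gamma n)
    (hP1 : forall n, lambda n.+1 + lambda n = P1.[theta n]) :
  (forall n, D_q P1 P2 Dp D (q_seq p eps gamma n)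
             = lambda n *: q_seq p eps gamma n) /\
  A (D_q P1 P2 Dp D).

Proof.
have linD : linear D by case: hD.
have DpZ : scalable Dp := GRing.scalable_linear (opalg_linear hA hDpA).
have P2A : A (op_poly P2 Dp) by exact: op_poly_in_algebra.
have DqA : A (D_q P1 P2 Dp D).
  apply: (opalg_add hA); last exact: (opalg_comp hA hDA P2A).
  by apply: (opalg_scale hA); exact: op_poly_in_algebra.
split=> // n.
have [DqZ DqD] : semilinear (D_q P1 P2 Dp D) :=
  GRing.semilinear_linear (opalg_linear hA DqA).
have DZ : scalable D := GRing.scalable_linear linD.
have Dq_p k : D_q P1 P2 Dp D (p k) =
    (2^-1 * (lambda k.+1 + lambda k)) *: p k + gamma k.+1 *: D (p k).
  rewrite -[LHS]/(2^-1 *: op_poly P1 Dp (p k) + D (op_poly P2 Dp (p k))).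
  by rewrite !(op_poly_eigen _ DpZ (hDp k)) DZ scalerA hP1 hgamma.
have half_sum k :
    2^-1 * (lambda k.+1 + lambda k) =
    lambda k + 2^-1 * (sigma k.+1 * gamma k.+1).
  by rewrite -(hlambda k.+1) //=; field.
case: n => [|n] /=.
  (* p_0 is a nonzero constant, so the eigenvector p_0 can be replaced by 1. *)
  have /size_poly1P[c c_neq0 p0E] : size (p 0%N) == 1%N by rewrite hp.
  have -> : 1 = c^-1 *: p 0%N by rewrite p0E -mul_polyC -polyCM mulVf.
  rewrite DqZ Dq_p half_sum (D_type2_0 hD) !scalerA -scalerDl scalerA.
  by congr (_ *: _); ring.
have gamma_neq0 : gamma n.+1 != 0 by rewrite hgamma.
have eps_gamma : eps n.+1 * gamma n.+2 = beta eps gamma n.+1 * gamma n.+1.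
  by rewrite /beta; field.
move: (beta eps gamma n.+1) eps_gamma => b eps_gamma.
have D_pS : gamma n.+2 *: D (p n.+1) =
    - (2^-1 * sigma n.+2 * gamma n.+2) *: p n.+1
    + (b * gamma n.+1 * (2^-1 * sigma n.+1)) *: p n
    - (b * gamma n.+1) *: D (p n).
  rewrite -eps_gamma -[D (p n.+1)](addrK (eps n.+1 *: D (p n))).
  rewrite (D_type2_recurrence n hD).
  by rewrite -!mul_polyC !(rmorphM, rmorphN, rmorphD) /=; ring.
rewrite DqD DqZ !Dq_p D_pS half_sum.
(* lambda_(n+1) is the left end of the half sum at n.+1 and the right end of
   the half sum at n. *)
have -> : 2^-1 * (lambda n.+1 + lambda n) =
    lambda n.+1 - 2^-1 * (sigma n.+1 * gamma n.+1).
  by rewrite -(hlambda n.+1) //=; field.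
by rewrite -!mul_polyC !(rmorphM, rmorphN, rmorphD) /=; ring.
Qed.
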